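(* Let $B$ be a barcode with $n^B\ge 2$ bars and let $\bar\ell_B:=L^B/n^B$ denote its mean bar length. (1) Adding a bar $[b,b+\ell)$ of length $\ell\ge 0$ to $B$ yields $$\mathrm{TSI}(B\cup\{[b,b+\ell)\})=\frac{n^B-1}{n^B}\,\mathrm{TSI}(B)+\frac{1}{n^B+1}\left(\ell-\bar\ell_B\right)^2.$$ (2) If moreover $n^B\ge 3$, then removing from $B$ (one copy of) a bar $[b,b+\ell)\in B$ of length $\ell$ gives $$\mathrm{TSI}(B\setminus\{[b,b+\ell)\})=\frac{n^B-1}{n^B-2}\,\mathrm{TSI}(B)-\frac{n^B}{(n^B-1)(n^B-2)}\left(\ell-\bar\ell_B\right)^2.$$
   Context: A barcode $B=\{[b_i,d_i)\}_{i=1}^{n^B}$ is a finite multiset of bars, each given by its pair of real endpoints $b_i\le d_i$ (zero-length bars are allowed); $n^B$ is the number of bars counted with multiplicity, $\ell_i=d_i-b_i\ge 0$ are the bar lengths (lifetimes), and $L^B=\sum_{i=1}^{n^B}\ell_i$ is the total persistence. Union and difference are in the multiset sense, so adding (removing) a bar changes the number of bars by exactly one. The Topological Stability Index is the unbiased sample variance of the lifetimes: for $n^B\ge 2$, $$\mathrm{TSI}(B)=\frac{1}{n^B-1}\sum_{i=1}^{n^B}\left(\ell_i-\frac{L^B}{n^B}\right)^2,$$ and $\mathrm{TSI}(B)=0$ if $n^B\le 1$. *)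

(* Defs.v *)
From HB Require Import structures.
From mathcomp Require Import all_boot all_order all_algebra.
From mathcomp Require Import finmap multiset.
From mathcomp Require Import reals.

Set Implicit Arguments.
Unset Strict Implicit.
Unset Printing Implicit Defensive.

Import Order.TTheory GRing.Theory Num.Theory.

Local Open Scope ring_scope.
Local Open Scope mset_scope.

Record bar (R : realType) := Bar {
  endpoints : R * R;
  _ : endpoints.1 <= endpoints.2
}.

HB.instance Definition _ (R : realType) := [isSub for @endpoints R].
HB.instance Definition _ (R : realType) := [Choice of bar R by <:].

Definition birth (R : realType) (x : bar R) : R := (endpoints x).1.
Definition death (R : realType) (x : bar R) : R := (endpoints x).2.
Definition lifetime (R : realType) (x : bar R) : R := death x - birth x.

Lemma interval_bar_subproof (R : realType) (b l : R) :
  0 <= l -> (b, b + l).1 <= (b, b + l).2.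
Proof. by rewrite /= lerDl. Qed.

(* The bar [b, b + l). *)
Definition interval_bar (R : realType) (b l : R) (hl : 0 <= l) : bar R :=
  Bar (interval_bar_subproof b hl).

Notation barcode R := {mset (bar R)}.

(* A multiset coerces to the sequence that lists each element as many times as
   its multiplicity, so sizes and sums over a barcode count repeated bars. *)
Definition nbars (R : realType) (B : barcode R) : nat := size B.

Definition total_persistence (R : realType) (B : barcode R) : R :=
  \sum_(x <- B) lifetime x.

Definition mean_lifetime (R : realType) (B : barcode R) : R :=
  total_persistence B / (nbars B)%:R.

Definition TSI (R : realType) (B : barcode R) : R :=
  if (2 <= nbars B)%N then
    ((nbars B)%:R - 1)^-1 * \sum_(x <- B) (lifetime x - mean_lifetime B) ^+ 2
  else 0.

(* Main.v *)
Require Import Defs.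
From mathcomp Require Import all_boot all_order all_algebra.
From mathcomp Require Import finmap multiset.
From mathcomp Require Import reals.
From mathcomp Require Import ring.

(** Adding one bar moves the mean by a known amount and leaves every other
lifetime alone, so the only issue is how a sum of squared deviations reacts to
a change of its centre.  The parallel-axis identity [sum_sq_dev_shift] answers
this: recentring from the mean [m] to [c] costs exactly [n * (m - c) ^+ 2],
because the cross term is a multiple of the sum of the deviations from the
mean, which vanishes.  For an added bar of length [l], the new bar and the old
mean lie at signed distances [n / (n + 1) * (l - m)] and
[- (l - m) / (n + 1)] from the new mean; their contributions
[(n / (n + 1)) ^+ 2] and [n / (n + 1) ^+ 2] to the coefficient of
[(l - m) ^+ 2] add up to [n / (n + 1)], which after division by [n] is the
insertion formula [TSI_add].

Removal is insertion read backwards: [B] is its remainder [A] with the bar put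
back, so [TSI_add] can be solved for [TSI A].  The formula obtained is centred
at the mean of [A]; the same mean update, [dev_mean_lifetime_add], turns it
into the mean of [B]. *)

Set Implicit Arguments.
Unset Strict Implicit.
Unset Printing Implicit Defensive.

Import Order.TTheory GRing.Theory Num.Theory.

Local Open Scope ring_scope.
Local Open Scope mset_scope.

Lemma perm_add_bar (R : realType) (B : barcode R) (x : bar R) :
  perm_eq (B `+` [mset x]) (x :: B).
Proof.
apply/allP => a _ /=; rewrite !count_mem_mset msetDC mset1DE (eq_sym x).
exact: eqxx.
Qed.

Lemma nbars_add (R : realType) (B : barcode R) (x : bar R) :
  nbars (B `+` [mset x]) = (nbars B).+1.
Proof. exact: perm_size (perm_add_bar B x). Qed.

Lemma big_add_bar (R : realType) (B : barcode R) (x : bar R) (F : bar R -> R) :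
  \sum_(y <- B `+` [mset x]) F y = F x + \sum_(y <- B) F y.
Proof. by rewrite (perm_big _ (perm_add_bar B x)) big_cons. Qed.

Lemma lifetime_interval_bar (R : realType) (b l : R) (hl : 0 <= l) :
  lifetime (interval_bar b hl) = l.
Proof. by rewrite /lifetime /death /birth /= addrC addKr. Qed.

(** The parallel-axis identity: the cross term
[2 * (m - c) * \sum_x (lifetime x - m)] vanishes when [m] is the mean. *)
Lemma sum_sq_dev_shift (R : realType) (B : barcode R) (c : R) :
  (0 < nbars B)%N ->
  \sum_(x <- B) (lifetime x - c) ^+ 2 =
    \sum_(x <- B) (lifetime x - mean_lifetime B) ^+ 2
    + (nbars B)%:R * (mean_lifetime B - c) ^+ 2.
Proof.
move=> B_gt0; set m := mean_lifetime B.
have n_neq0 : (nbars B)%:R != 0 :> R by rewrite pnatr_eq0 -lt0n.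
have sum_cst (a : R) : \sum_(x <- B) a = (nbars B)%:R * a.
  by rewrite big_const_seq count_predT iter_addr_0 mulr_natl.
have sum_dev0 : \sum_(x <- B) (lifetime x - m) = 0.
  by rewrite sumrB sum_cst /m /mean_lifetime mulrC divfK // subrr.
have expand x : (lifetime x - c) ^+ 2 =
    (lifetime x - m) ^+ 2 + (2 * (m - c) * (lifetime x - m) + (m - c) ^+ 2).
  by ring.
rewrite (eq_bigr _ (fun x _ => expand x)) !big_split /= -mulr_sumr sum_dev0.
by rewrite sum_cst mulr0 add0r.
Qed.

(** The new bar pulls the mean towards itself, which shrinks its own deviation
by the factor [n / (n + 1)].  Insertion uses this as it stands; removal uses it
to pass from the mean of the remainder to the mean of the whole barcode. *)
Lemma dev_mean_lifetime_add (R : realType) (B : barcode R) (x : bar R) :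
  (0 < nbars B)%N ->
  lifetime x - mean_lifetime (B `+` [mset x]) =
    (nbars B)%:R / ((nbars B)%:R + 1) * (lifetime x - mean_lifetime B).
Proof.
move=> B_gt0; rewrite /mean_lifetime /total_persistence big_add_bar nbars_add.
have n_neq0 : (nbars B)%:R != 0 :> R by rewrite pnatr_eq0 -lt0n.
have : (nbars B).+1%:R != 0 :> R by rewrite pnatr_eq0.
by rewrite -natr1 => n1_neq0; field; rewrite n1_neq0 n_neq0.
Qed.

Lemma sum_sq_dev_add (R : realType) (B : barcode R) (x : bar R) :
  (0 < nbars B)%N ->
  \sum_(y <- B `+` [mset x])
      (lifetime y - mean_lifetime (B `+` [mset x])) ^+ 2 =
    \sum_(y <- B) (lifetime y - mean_lifetime B) ^+ 2
    + (nbars B)%:R / ((nbars B)%:R + 1) * (lifetime x - mean_lifetime B) ^+ 2.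
Proof.
move=> B_gt0; rewrite big_add_bar.
rewrite (sum_sq_dev_shift (mean_lifetime (B `+` [mset x]))) //.
have -> : mean_lifetime (B `+` [mset x]) = lifetime x -
    (nbars B)%:R / ((nbars B)%:R + 1) * (lifetime x - mean_lifetime B).
  by rewrite -dev_mean_lifetime_add // subKr.
have : (nbars B).+1%:R != 0 :> R by rewrite pnatr_eq0.
by rewrite -natr1 => n1_neq0; field.
Qed.

Lemma TSI_add (R : realType) (B : barcode R) (x : bar R) :
  (2 <= nbars B)%N ->
  TSI (B `+` [mset x]) =
    ((nbars B)%:R - 1) / (nbars B)%:R * TSI B
    + ((nbars B)%:R + 1)^-1 * (lifetime x - mean_lifetime B) ^+ 2.
Proof.
move=> B_ge2; have B_gt0 : (0 < nbars B)%N by exact: ltnW.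
rewrite /TSI sum_sq_dev_add // nbars_add ltnS B_gt0 B_ge2 -natr1 addrK.
have n_neq0 : (nbars B)%:R != 0 :> R by rewrite pnatr_eq0 -lt0n.
have n_sub1_neq0 : (nbars B)%:R - 1 != 0 :> R.
  by rewrite subr_eq0 pnatr_eq1 gtn_eqF.
have : (nbars B).+1%:R != 0 :> R by rewrite pnatr_eq0.
by rewrite -natr1 => n1_neq0; field; rewrite n_sub1_neq0 n1_neq0 n_neq0.
Qed.

(** With [A] the remainder and [n = nbars A + 1], insertion reads
[TSI B = (n - 2) / (n - 1) * TSI A + d ^+ 2 / n], where [d] is the deviation of
[x] from the mean of [A], that is [n / (n - 1)] times its deviation from the
mean of [B].  Solving for [TSI A] divides by [n - 2], hence the three bars. *)
Lemma TSI_remove (R : realType) (B : barcode R) (x : bar R) :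
  (3 <= nbars B)%N -> x \in B ->
  TSI (B `\ x) =
    ((nbars B)%:R - 1) / ((nbars B)%:R - 2) * TSI B
    - (nbars B)%:R / (((nbars B)%:R - 1) * ((nbars B)%:R - 2))
      * (lifetime x - mean_lifetime B) ^+ 2.
Proof.
move=> B_ge3 x_in_B; set A := B `\ x.
have B_def : B = A `+` [mset x] by rewrite msetDC msetB1K.
have nB : nbars B = (nbars A).+1 by rewrite {1}B_def nbars_add.
have A_ge2 : (2 <= nbars A)%N by rewrite nB ltnS in B_ge3.
have A_gt0 : (0 < nbars A)%N by exact: ltnW.
rewrite nB {1 2}B_def TSI_add // dev_mean_lifetime_add // -natr1.
have n_neq0 : (nbars A)%:R != 0 :> R by rewrite pnatr_eq0 -lt0n.
have n_sub1_neq0 : (nbars A)%:R - 1 != 0 :> R.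
  by rewrite subr_eq0 pnatr_eq1 gtn_eqF.
have : (nbars A).+1%:R != 0 :> R by rewrite pnatr_eq0.
rewrite -natr1 => n1_neq0.
have -> : (nbars A)%:R + 1 - 2 = (nbars A)%:R - 1 :> R by ring.
by field; rewrite n1_neq0 n_sub1_neq0 addrK n_neq0.
Qed.

Theorem lemma2p2 (R : realType) (B : barcode R) (hB : (2 <= nbars B)%N) :
  (forall (b l : R) (hl : 0 <= l),
     TSI (B `+` [mset interval_bar b hl]) =
       ((nbars B)%:R - 1) / (nbars B)%:R * TSI B
       + ((nbars B)%:R + 1)^-1 * (l - mean_lifetime B) ^+ 2)
  /\
  ((3 <= nbars B)%N ->
   forall (b l : R) (hl : 0 <= l), interval_bar b hl \in B ->
     TSI (B `\ interval_bar b hl) =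
       ((nbars B)%:R - 1) / ((nbars B)%:R - 2) * TSI B
       - (nbars B)%:R / (((nbars B)%:R - 1) * ((nbars B)%:R - 2))
         * (l - mean_lifetime B) ^+ 2).
Proof.
split=> [b l hl|B_ge3 b l hl x_in_B].
  by rewrite TSI_add // lifetime_interval_bar.
by rewrite TSI_remove // lifetime_interval_bar.
Qed.
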